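(* Let $\lambda$ and $\delta$ be two proper partitions. Let $n$ be an integer sufficiently big and consider the equation $$\mathbf{C}_{\underline{\lambda}_n}\mathbf{C}_{\underline{\delta}_n}=\sum_{\rho \text{ proper partition}} c_{\lambda\delta}^{\rho}(n)\, \mathbf{C}_{\underline{\rho}_n}$$ in the center $Z(\mathbb{C}[\mathcal{S}_n])$ of the symmetric group algebra. The structure coefficients $c_{\lambda\delta}^{\rho}(n)$ are polynomials in $n$ with positive, rational coefficients.
   Context: A proper partition is a partition with no part equal to $1$ (the empty partition is allowed). For a proper partition $\lambda$ and $n\ge|\lambda|$, $\underline{\lambda}_n=\lambda\cup(1^{n-|\lambda|})$ is the partition of $n$ obtained by adding $n-|\lambda|$ parts equal to $1$. $C_{\underline{\lambda}_n}$ is the set of permutations in $\mathcal{S}_n$ of cycle-type $\underline{\lambda}_n$ and $\mathbf{C}_{\underline{\lambda}_n}$ is the sum of its elements in $\mathbb{C}[\mathcal{S}_n]$; these sums, for $\lambda$ proper with $|\lambda|\le n$, form a basis of $Z(\mathbb{C}[\mathcal{S}_n])$.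
   Formalization: ''Positive coefficients'' is read as nonnegative coefficients in the falling factorials of n−|ρ|, since in powers of n the claim fails: for λ=δ=(2) and ρ empty the coefficient is n²/2−n/2. *)

(* Defs.v *)
From mathcomp Require Import all_boot all_order all_fingroup all_algebra.
From mathcomp Require Import mxrepresentation.

Set Implicit Arguments.
Unset Strict Implicit.
Unset Printing Implicit Defensive.

Import Order.TTheory GRing.Theory Num.Theory.
Local Open Scope ring_scope.

(* Partitions are weakly decreasing lists of positive parts, and |rho| is
   [sumn rho]. *)
Definition proper_partition (rho : seq nat) : bool :=
  sorted geq rho && all (fun k => 1 < k)%N rho.

(* Meaningful only when [sumn rho <= n], as subtraction is truncated. *)
Definition completion (n : nat) (rho : seq nat) : seq nat :=
  rho ++ nseq (n - sumn rho) 1%N.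

(* [porbits s] contains the fixed points of [s] as singletons, so these
   contribute parts equal to 1. *)
Definition cycle_type (n : nat) (s : 'S_n) : seq nat :=
  sort geq [seq #|X| | X : {set 'I_n} in porbits s].

Definition cycle_class (n : nat) (rho : seq nat) : {set 'S_n} :=
  [set s : 'S_n | cycle_type s == completion n rho].

(* The group algebra C[S_n] is MathComp's [group_ring C [set: 'S_n]], the
   algebra spanned by the matrices of the (faithful) regular representation;
   [gset_mx C G A] is the sum of the elements of A in it, and [*m] its
   product. *)
Definition class_sum (C : fieldType) (n : nat) (rho : seq nat) :=
  gset_mx C [set: 'S_n] (cycle_class n rho).

(* A proper partition of size at most n has at most n parts, each at most n. *)
Definition proper_partitions (n : nat) : seq (seq nat) :=
  [seq rho <- [seq map val (b : seq 'I_n.+1) | b : n.-bseq 'I_n.+1]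
         | proper_partition rho && (sumn rho <= n)%N].

Lemma mem_proper_partitions n rho :
  (rho \in proper_partitions n) = proper_partition rho && (sumn rho <= n)%N.
Proof.
rewrite mem_filter; apply/andb_idr => /andP[/andP[_ rho_gt1] rho_le_n].
have size_le (s : seq nat) : all (fun k => 1 < k)%N s -> (size s <= sumn s)%N.
  elim: s => //= k s IHs /andP[k_gt1 /IHs]; rewrite -add1n.
  exact/leq_add/ltnW.
have part_le : all (fun k => k < n.+1)%N rho.
  apply/allP => k; rewrite ltnS => k_rho; apply: leq_trans rho_le_n.
  by rewrite sumnE (big_rem k) //= leq_addr.
have bP : (size [seq inord k : 'I_n.+1 | k <- rho] <= n)%N.
  by rewrite size_map (leq_trans (size_le _ rho_gt1)).
apply/imageP; exists (Bseq bP) => //=; rewrite -map_comp -[LHS]map_id.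
by apply/eq_in_map => k /(allP part_le) k_lt /=; rewrite inordK.
Qed.

Lemma proper_partitions_uniq n : uniq (proper_partitions n).
Proof.
apply/filter_uniq; rewrite map_inj_uniq ?enum_uniq // => b c /=.
by move/(inj_map val_inj)/val_inj.
Qed.

(* c lists the coordinates of the product of the class sums of lambda and delta
   on the basis of class sums of the center of C[S_n]. *)
Definition structure_coefficients (C : fieldType) (n : nat)
    (lambda delta : seq nat) (c : seq nat -> C) : Prop :=
  class_sum C n lambda *m class_sum C n delta =
    \sum_(rho <- proper_partitions n) c rho *: class_sum C n rho.

Definition falling_factorial (m j : nat) : {poly rat} :=
  \prod_(i < j) ('X - (m + i)%:R%:P).

(* Positivity of the coefficients refers to the falling factorials of n - m,
   taken below with m = |rho|. It fails for the powers of n: the product of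
   the sum of all transpositions with itself has coefficient
   n(n-1)/2 = n^2/2 - n/2 on the identity. *)
Definition nonneg_coefficients (m : nat) (p : {poly rat}) : Prop :=
  exists a : seq rat,
    all (fun x => 0 <= x) a /\
    p = \sum_(j < size a) a`_j *: falling_factorial m j.

(* Main.v *)
(* The coefficient on C_rho is the number of factorizations z = x y of a fixed z
   of proper type rho, with x and y of proper types lambda and delta. Sort them
   by A, the set of points moved by x or y but not by z. Restricting x, y and z
   to the points moved by x or y shows that the number of factorizations with a
   given A is an integer M_k depending only on rho and k = |A|, not on n, and
   M_k = 0 for k > |lambda| + |delta|. Hence the coefficient is
   sum_k M_k 'C(n - |rho|, k), and k! 'C(n - |rho|, k) is a falling factorial of
   n - |rho|. *)

Require Import Defs.
From mathcomp Require Import all_boot all_order all_fingroup all_algebra.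
From mathcomp Require Import mxrepresentation.

Import Order.TTheory GRing.Theory Num.Theory.
Local Open Scope ring_scope.

Set Implicit Arguments.
Unset Strict Implicit.
Unset Printing Implicit Defensive.

(** * Proper cycle types, supports and cycle classes *)

Section ProperType.

Local Open Scope nat_scope.

Definition moved (T : finType) (s : {perm T}) : {set T} := [set x | s x != x].

(** Without the fixed points the type no longer depends on the size of the ambient set, so
    permutations of different sets can be compared. *)
Definition proper_type (T : finType) (s : {perm T}) : seq nat :=
  sort geq [seq k <- [seq #|X| | X : {set T} in porbits s] | 1 < k].

Lemma geq_total : total geq.
Proof. by move=> m n; rewrite orbC leq_total. Qed.

Lemma geq_trans : transitive geq.
Proof. by move=> m n p /= le_mn le_pm; apply: leq_trans le_pm le_mn. Qed.

Lemma geq_anti : antisymmetric geq.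
Proof. by move=> m n /=; rewrite andbC => /anti_leq. Qed.

(** The positive parts discarded by the filter all equal 1, so their number is the difference of the
    two sums. *)
Lemma perm_completion (r : seq nat) : all (fun k => 0 < k) r ->
  perm_eq r (completion (sumn r) [seq k <- r | 1 < k]).
Proof.
move=> r_gt0; rewrite /completion perm_sym.
suff -> : nseq (sumn r - sumn [seq k <- r | 1 < k]) 1 =
    filter (predC (fun k => 1 < k)) r by rewrite perm_filterC.
elim: r r_gt0 => //= k r IHr /andP[k_gt0 /IHr {}IHr].
(* Because subtraction is truncated, the case of a head equal to 1 relies on this inequality. *)
have sum_le : sumn [seq k <- r | 1 < k] <= sumn r.
  by elim: (r) => //= j r' IH; case: ifP => _ /=;
    rewrite ?leq_add2l // (leq_trans IH) ?leq_addl.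
case: k k_gt0 => [|[|k]] //= _; last by rewrite subnDl.
by rewrite add1n subSn //= IHr.
Qed.

Lemma mem_porbits (T : finType) (s : {perm T}) x : porbit s x \in porbits s.
Proof. exact: imset_f. Qed.

Lemma porbit_fixed (T : finType) (s : {perm T}) x :
  s x = x -> porbit s x = [set x].
Proof.
move=> sx; apply/setP=> y; rewrite inE; apply/porbitP/eqP=> [[i ->] | ->].
  by elim: i => [|i IHi]; rewrite ?perm1 // expgSr permM IHi.
by exists 0; rewrite perm1.
Qed.

(** An orbit meeting [D] is either a single fixed point or made of moved points, all of which lie in
    [D]. So [D] is a union of orbits. *)
Lemma partition_porbits (T : finType) (s : {perm T}) (D : {set T}) :
  moved s \subset D -> partition [set X in porbits s | X \subset D] D.
Proof.
move=> sD; apply/and3P; split.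
- apply/eqP/setP=> x; apply/bigcupP/idP => [[X] | Dx].
    by rewrite inE => /andP[_ /subsetP XD] /XD.
  exists (porbit s x); rewrite ?porbit_id // inE mem_porbits /=.
  apply/subsetP=> y xy; case: (eqVneq (s y) y) => [sy | sy].
    by move: xy; rewrite porbit_sym porbit_fixed // inE => /eqP <-.
  by apply: (subsetP sD); rewrite inE.
- apply/trivIsetP=> X Y; rewrite !inE.
  move=> /andP[/imsetP[x _ ->] _] /andP[/imsetP[y _ ->] _] neq_xy.
  apply/pred0P=> z /=; apply/negbTE; apply: contra neq_xy => /andP[].
  by rewrite -!eq_porbit_mem => /eqP <- /eqP <-.
- apply/negP; rewrite !inE => /andP[/imsetP[x _ s0]].
  by move: (porbit_id s x); rewrite -s0 inE.
Qed.

Lemma nontrivial_porbit_moved (T : finType) (s : {perm T}) (X : {set T}) :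
  X \in porbits s -> 1 < #|X| -> X \subset moved s.
Proof.
move=> /imsetP[x _ ->] x_gt1; apply/subsetP=> y xy; rewrite inE.
apply: contraL x_gt1 => /eqP sy.
by move: xy; rewrite -eq_porbit_mem => /eqP <-; rewrite porbit_fixed // cards1.
Qed.

(** A general [D] allows [s] to be viewed as a permutation of any set containing its support;
    [D = setT] gives the full cycle type. *)
Lemma perm_porbits_card (T : finType) (s : {perm T}) (D : {set T}) :
  moved s \subset D ->
  perm_eq [seq #|X| | X : {set T} in [set X in porbits s | X \subset D]]
          (completion #|D| (proper_type s)).
Proof.
move=> sD; have part := partition_porbits sD.
set P := [set X in _ | _] in part *.
have r_gt0 : all (fun k => 0 < k) [seq #|X| | X : {set T} in P].
  apply/allP=> _ /imageP[X XP ->]; rewrite card_gt0.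
  by case/and3P: part => _ _; apply: contra => /eqP <-.
have Er : sumn [seq #|X| | X : {set T} in P] = #|D|.
  by rewrite (card_partition part) sumnE big_image.
apply: perm_trans (perm_completion r_gt0) _; rewrite Er.
have rs : perm_eq [seq k <- [seq #|X| | X : {set T} in P] | 1 < k]
    (proper_type s).
  rewrite perm_sym perm_sort !filter_map; apply: perm_map.
  apply: uniq_perm => [||X]; [exact/filter_uniq/enum_uniq..|].
  rewrite [LHS]mem_filter [RHS]mem_filter !mem_enum /= /P inE.
  case: (boolP (1 < #|X|)) => //= X_gt1; case: (boolP (X \in _)) => //= Xs.
  by rewrite (subset_trans _ sD) ?nontrivial_porbit_moved.
by rewrite /completion (perm_sumn rs) perm_cat2r.
Qed.

Lemma perm_proper_type (T : finType) (s : {perm T}) :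
  perm_eq (proper_type s)
    [seq #|X| | X : {set T} in [set X in porbits s | 1 < #|X|]].
Proof.
rewrite /proper_type perm_sort filter_map; apply: perm_map.
apply: uniq_perm => [||X]; [exact/filter_uniq/enum_uniq|exact: enum_uniq|].
by rewrite [LHS]mem_filter !mem_enum [RHS]inE andbC.
Qed.

(** The orbits with more than one element are exactly those contained in [moved s], and they
    partition it. *)
Lemma sumn_proper_type (T : finType) (s : {perm T}) :
  sumn (proper_type s) = #|moved s|.
Proof.
rewrite (perm_sumn (perm_proper_type s)) sumnE big_image /=.
rewrite (card_partition (partition_porbits (subxx (moved s)))).
rewrite [RHS](bigID (fun X : {set T} => 1 < #|X|)) /=.
rewrite [X in _ = _ + X]big1 ?addn0 => [|X].
  apply: eq_bigl => X; rewrite !inE -andbA.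
  case Xs: (X \in _) => //=; case X1: (1 < #|X|); rewrite ?andbF ?andbT //.
  by rewrite nontrivial_porbit_moved.
rewrite inE -andbA => /and3P[/imsetP[x _ ->] /subsetP sub].
rewrite -leqNgt => /card_le1_eqP x1; move: (sub x (porbit_id s x)).
rewrite inE => /eqP[]; apply: x1; first exact: porbit_id.
exact: (mem_porbit s 1).
Qed.

Lemma proper_partition_type (T : finType) (s : {perm T}) :
  proper_partition (proper_type s).
Proof.
rewrite /proper_partition /proper_type (sort_sorted geq_total) /=.
by rewrite all_sort filter_all.
Qed.

(** Removing the parts 1 from a completion gives [rho] back. Conversely, the cycle type is a
    rearrangement of the completed proper type, and two weakly decreasing rearrangements of each
    other coincide. *)
Lemma cycle_class_proper (n : nat) (rho : seq nat) : proper_partition rho ->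
  cycle_class n rho = [set s : 'S_n | proper_type s == rho].
Proof.
move=> /andP[rho_sorted rho_gt1]; apply/setP=> s; rewrite !inE.
have Es : perm_eq (cycle_type s) (completion n (proper_type s)).
  rewrite /cycle_type perm_sort.
  have := perm_porbits_card (subsetT (moved s)); rewrite cardsT card_ord.
  suff -> : [set X in porbits s | X \subset [set: 'I_n]] = porbits s by [].
  by apply/setP=> X; rewrite inE subsetT andbT.
have filterE r : all (fun k => 1 < k) r ->
    [seq k <- completion n r | 1 < k] = r.
  move=> r1; rewrite /completion filter_cat filter_nseq /= cats0.
  exact/all_filterP.
have completion_sorted : sorted geq (completion n rho).
  rewrite /completion (sorted_pairwise geq_trans) pairwise_cat.
  rewrite -!(sorted_pairwise geq_trans) rho_sorted /=; apply/andP; split.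
    apply/allrelP=> j k /(allP rho_gt1) j_gt1.
    by rewrite mem_nseq => /andP[_ /eqP->]; apply: ltnW.
  by elim: (n - _) => //= -[|m] //= ->.
apply/eqP/eqP => [E | E].
  rewrite -(filterE rho rho_gt1) -E /cycle_type filter_sort //.
  exact: geq_trans.
apply: (sorted_eq geq_trans geq_anti) => //.
  exact: sort_sorted geq_total _.
by rewrite -E.
Qed.

(** * Extending a permutation by the identity along an injection *)

Section Extension.

Variables (T1 T2 : finType) (f : T1 -> T2) (f_inj : injective f).
Implicit Types s t : {perm T1}.

Definition ext_fun s y := if [pick x | f x == y] is Some x then f (s x) else y.

Lemma ext_funE s x : ext_fun s (f x) = f (s x).
Proof.
by rewrite /ext_fun; case: pickP => [z /eqP/f_inj -> //|/(_ x)]; rewrite eqxx.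
Qed.

Lemma ext_fun_out s y : y \notin f @: T1 -> ext_fun s y = y.
Proof.
move=> fy; rewrite /ext_fun; case: pickP => // x /eqP xy.
by case/imsetP: fy; exists x.
Qed.

Lemma ext_fun_inj s : injective (ext_fun s).
Proof.
suff fK : cancel (ext_fun s) (ext_fun s^-1) by apply: can_inj fK.
move=> y; case: (boolP (y \in f @: T1)) => [/imsetP[x _ ->] | fy].
  by rewrite !ext_funE permK.
by rewrite !ext_fun_out.
Qed.

Definition ext_perm s : {perm T2} := perm (@ext_fun_inj s).

Lemma ext_permE s x : ext_perm s (f x) = f (s x).
Proof. by rewrite permE ext_funE. Qed.

Lemma ext_perm_out s y : y \notin f @: T1 -> ext_perm s y = y.
Proof. by rewrite permE; apply: ext_fun_out. Qed.

Lemma ext_permM s t : ext_perm (s * t) = (ext_perm s * ext_perm t)%g.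
Proof.
apply/permP=> y; rewrite permM.
case: (boolP (y \in f @: T1)) => [/imsetP[x _ ->] | fy].
  by rewrite !ext_permE permM.
by rewrite !ext_perm_out.
Qed.

Lemma ext_perm_inj : injective ext_perm.
Proof.
move=> s t st; apply/permP=> x; apply: f_inj.
by rewrite -!ext_permE st.
Qed.

Lemma moved_ext_perm s : moved (ext_perm s) = f @: moved s.
Proof.
apply/setP=> y; case: (boolP (y \in f @: T1)) => [/imsetP[x _ ->] | fy].
  by rewrite mem_imset // !inE ext_permE (inj_eq f_inj).
rewrite inE ext_perm_out // eqxx; apply/esym/negbTE; apply: contra fy.
by case/imsetP=> x _ ->; apply: imset_f.
Qed.

Lemma ext_perm_uniq s (u : {perm T2}) :
  moved u \subset f @: T1 -> (forall x, u (f x) = f (s x)) -> ext_perm s = u.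
Proof.
move=> uf us; apply/permP=> y.
case: (boolP (y \in f @: T1)) => [/imsetP[x _ ->] | fy].
  by rewrite ext_permE us.
rewrite ext_perm_out //; apply/esym/eqP; apply: contraR fy => uy.
by apply: (subsetP uf); rewrite inE.
Qed.

(** A permutation sends moved points to moved points, so [u] preserves the image of [f] and can be
    pulled back along [f]. *)
Lemma ext_perm_onto (u : {perm T2}) :
  moved u \subset f @: T1 -> exists s, ext_perm s = u.
Proof.
move=> uf.
have uf_im x : exists z, u (f x) == f z.
  have [ufx|ufx] := eqVneq (u (f x)) (f x); first by exists x; rewrite ufx.
  have /imsetP[z _ ->] : u (f x) \in f @: T1; last by exists z.
  by apply: (subsetP uf); rewrite inE (inj_eq perm_inj).
pose g x := xchoose (uf_im x).
have gE x : u (f x) = f (g x) by apply/eqP/(xchooseP (uf_im x)).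
have g_inj : injective g.
  by move=> x y xy; apply/f_inj/(@perm_inj _ u); rewrite !gE xy.
by exists (perm g_inj); apply: ext_perm_uniq => // x; rewrite permE.
Qed.

Lemma porbit_ext_perm s x : porbit (ext_perm s) (f x) = f @: porbit s x.
Proof.
have powE i : (ext_perm s ^+ i)%g (f x) = f ((s ^+ i)%g x).
  by elim: i => [|i IHi]; rewrite ?perm1 // !expgSr !permM IHi ext_permE.
apply/setP=> y; apply/porbitP/imsetP => [[i ->] | [_ /porbitP[i ->] ->]].
  by exists ((s ^+ i)%g x); rewrite ?mem_porbit.
by exists i.
Qed.

(** The extension only adds fixed points: its nontrivial orbits are the images under [f] of those of
    [s], with the same cardinalities. *)
Lemma proper_type_ext_perm s : proper_type (ext_perm s) = proper_type s.
Proof.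
apply: (sorted_eq geq_trans geq_anti); try exact: sort_sorted geq_total _.
apply: perm_trans (perm_proper_type _) _.
rewrite perm_sym; apply: perm_trans (perm_proper_type _) _.
have -> : [set X in porbits (ext_perm s) | 1 < #|X|] =
    (fun X : {set T1} => f @: X) @: [set X in porbits s | 1 < #|X|].
  apply/setP=> X; apply/idP/imsetP => [|[Y]].
    rewrite inE => /andP[/imsetP[y _ ->]].
    case: (boolP (y \in f @: T1)) => [/imsetP[x _ ->] | fy].
      rewrite porbit_ext_perm card_imset // => x_gt1.
      by exists (porbit s x); rewrite // inE mem_porbits.
    by rewrite porbit_fixed ?cards1 // ext_perm_out.
  rewrite inE => /andP[/imsetP[x _ ->] x_gt1] ->.
  by rewrite inE -porbit_ext_perm mem_porbits porbit_ext_perm card_imset.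
set P := [set X in _ | _].
have -> : [seq #|X| | X : {set T1} in P] =
    [seq #|pred_of_set X| | X <- [seq f @: X | X : {set T1} <- enum P]].
  by rewrite -map_comp; apply: eq_map => X /=; rewrite card_imset.
apply: perm_map; apply: uniq_perm => [||X].
- by rewrite map_inj_uniq ?enum_uniq //; apply: imset_inj.
- exact: enum_uniq.
rewrite mem_enum; apply/mapP/imsetP => -[Y YP ->]; exists Y => //.
  by rewrite -mem_enum.
by rewrite mem_enum.
Qed.

End Extension.

(** * Permutations of a given proper type: intertwining and existence *)

Lemma perm_map_matching (A B : eqType) (x0 : B) (a : A -> nat) (b : B -> nat)
    (s1 : seq A) (s2 : seq B) :
    uniq s1 -> uniq s2 -> perm_eq (map a s1) (map b s2) ->
  exists phi : A -> B,
    {in s1, forall x, phi x \in s2 /\ b (phi x) = a x} /\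
    {in s1 &, injective phi}.
Proof.
move=> s1_uniq s2_uniq /(perm_iotaP 0)[Is]; rewrite size_map => Is_perm Es.
have Is_size : size Is = size s1 by rewrite -(size_map a s1) Es size_map.
have Is_lt x : x \in s1 -> nth 0 Is (index x s1) < size s2.
  move=> xs; have: nth 0 Is (index x s1) \in Is.
    by rewrite mem_nth // Is_size index_mem.
  by rewrite (perm_mem Is_perm) mem_iota.
(* [Is] rearranges the indices of [s2] so that the values agree entry by entry; the map follows it
   from positions in [s1] to positions in [s2]. *)
exists (fun x => nth x0 s2 (nth 0 Is (index x s1))); split=> [x xs | x y xs ys].
  split; first exact/mem_nth/Is_lt.
  rewrite -(nth_map x0 0) ?Is_lt // -(nth_map 0 0) -?Es ?Is_size ?index_mem //.
  by rewrite (nth_map x) ?index_mem // nth_index.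
move/eqP; rewrite nth_uniq ?Is_lt // nth_uniq ?Is_size ?index_mem //.
  by move/eqP/(congr1 (nth x s1)); rewrite !nth_index.
by rewrite (perm_uniq Is_perm) iota_uniq.
Qed.

(** Whether two powers agree at a point depends only on the orbit size. This allows positions on two
    cycles of equal length to be compared. *)
Lemma eq_porbit_pow (T : finType) (s : {perm T}) x i j :
  ((s ^+ i)%g x == (s ^+ j)%g x) = (i == j %[mod #|porbit s x|]).
Proof.
set k := #|_|; have k_gt0 : 0 < k by rewrite lt0n card_porbit_neq0.
have powE l : (s ^+ l)%g x = nth x (traject s x k) (l %% k).
  rewrite nth_traject ?ltn_mod // permX {1}(divn_eq l k) addnC iterD.
  congr iter.
  by elim: (l %/ k) => //= q IHq; rewrite mulSn iterD IHq iter_porbit.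
by rewrite !powE nth_uniq ?size_traject ?ltn_mod ?uniq_traject_porbit.
Qed.

(* Both the conjugacy of permutations of equal cycle type and the transport of
   a permutation between sets of different sizes are cases of this lemma. *)
Lemma proper_type_intertwine (T1 T2 : finType) (s : {perm T1}) (t : {perm T2})
    (D : {set T2}) :
    moved t \subset D -> #|D| = #|T1| -> proper_type s = proper_type t ->
  exists f : T1 -> T2,
    [/\ injective f, f @: T1 = D & forall x, t (f x) = f (s x)].
Proof.
move=> tD card_D st.
have := perm_porbits_card tD; rewrite -st card_D -cardsT perm_sym => D_perm.
have := perm_trans (perm_porbits_card (subsetT (moved s))) D_perm.
case/(perm_map_matching set0 (enum_uniq _) (enum_uniq _)) => phi.
set P := [set X in _ | _] => -[phiP phi_inj].
have Ps x : porbit s x \in enum P by rewrite mem_enum inE mem_porbits subsetT.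
have {}phiP x : [/\ phi (porbit s x) \in porbits t, phi (porbit s x) \subset D
    & #|phi (porbit s x)| = #|porbit s x| ].
  by have [] := phiP _ (Ps x); rewrite mem_enum inE => /andP[].
(* The intertwiner is built cycle by cycle. [phi] matches each orbit of [s] with an orbit of [t] of
   the same size; [a x] and [b x] are base points of these two orbits, depending only on the orbit
   of [x]. *)
pose a x := choose (mem (porbit s x)) x.
have a_in x : a x \in porbit s x.
  by apply: (@chooseP _ (mem (porbit s x))); apply: porbit_id.
have a_eq x y : porbit s x = porbit s y -> a x = a y.
  move=> xy; rewrite /a xy; apply: choose_id; last exact: porbit_id.
  by rewrite -xy; apply: porbit_id.
have b_ex x : exists z, z \in phi (porbit s x).
  apply/set0Pn; rewrite -card_gt0; case: (phiP x) => _ _ ->.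
  by rewrite lt0n card_porbit_neq0.
pose b x := xchoose (b_ex x).
have b_eq x y : porbit s x = porbit s y -> b x = b y.
  by move=> xy; apply: eq_xchoose => z; rewrite xy.
have b_in x : b x \in phi (porbit s x) := xchooseP (b_ex x).
have b_orb x : porbit t (b x) = phi (porbit s x).
  case: (phiP x) (b_in x) => /imsetP[z _ ->] _ _.
  by rewrite -eq_porbit_mem => /eqP.
have i_ex x : exists i, x == (s ^+ i)%g (a x).
  by have := a_in x; rewrite porbit_sym => /porbitP[i xE]; exists i; apply/eqP.
pose i x := xchoose (i_ex x).
have iE x : x = (s ^+ i x)%g (a x) := eqP (xchooseP (i_ex x)).
have card_ab x : #|porbit t (b x)| = #|porbit s (a x)|.
  rewrite b_orb; case: (phiP x) => _ _ ->.
  by have := a_in x; rewrite -eq_porbit_mem => /eqP->.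
(* The point [i x] steps of [s] after [a x] goes to the point as many steps of [t] after [b x]. The
   choice of [i x] is harmless, since exponents count modulo the common orbit size. *)
pose f x := (t ^+ i x)%g (b x).
have f_orb x : porbit t (f x) = phi (porbit s x) by rewrite porbit_perm b_orb.
have f_inj : injective f.
  move=> x y fxy; have xy : porbit s x = porbit s y.
    by apply: phi_inj => //; rewrite -!f_orb fxy.
  move/eqP: fxy; rewrite /f -(b_eq _ _ xy) eq_porbit_pow card_ab -eq_porbit_pow.
  by rewrite [in X in _ == X](a_eq _ _ xy) -!iE => /eqP.
exists f; split=> //; last first.
  move=> x; have xs : porbit s (s x) = porbit s x by apply: (porbit_perm s 1).
  rewrite /f -permM -expgSr (b_eq _ _ xs); apply/eqP.
  rewrite eq_porbit_pow card_ab -eq_porbit_pow expgSr permM -iE.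
  by rewrite -[in X in _ == X](a_eq _ _ xs) -iE.
apply/eqP; rewrite eqEcard card_imset // card_D leqnn andbT.
apply/subsetP=> _ /imsetP[x _ ->]; case: (phiP x) => _ /subsetP sub _.
by apply: sub; rewrite -f_orb porbit_id.
Qed.

(** Take the disjoint union of blocks whose sizes are the parts of [rho], rotate each block
    cyclically, and extend by fixed points to ['I_n]. *)
Lemma proper_type_exists (rho : seq nat) (n : nat) :
    proper_partition rho -> sumn rho <= n ->
  exists s : 'S_n, proper_type s = rho.
Proof.
move=> /andP[rho_sorted rho_gt1] rho_n.
pose T := {i : 'I_(size rho) & 'I_(nth 0 rho i)}.
pose T_ (i : 'I_(size rho)) := 'I_(nth 0 rho i).
pose rot (u : T) : T := Tagged T_ (ordS (tagged u)).
have rot_inj : injective rot.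
  case=> i x [j y] E; move: (congr1 tag E) => /= ij.
  case: j / ij y E => y /eqP; rewrite eq_Tagged => /eqP /= xy.
  by rewrite (ordS_inj xy).
pose s := perm rot_inj.
have pow_s k i (x : T_ i) :
    exists2 y : T_ i, (s ^+ k)%g (Tagged T_ x) = Tagged T_ y
                    & y = (x + k) %% nth 0 rho i :> nat.
  elim: k => [|k [y Ey Vy]].
    by exists x; rewrite ?perm1 // addn0 modn_small // ltn_ord.
  exists (ordS y); first by rewrite expgSr permM Ey permE.
  by rewrite /= Vy -addn1 modnDml addn1 addnS.
have porbit_s u : porbit s u = [set v | tag v == tag u].
  apply/setP=> v; rewrite inE; case: u v => i x [j y] /=.
  apply/porbitP/eqP => [[k] | ji].
    by have [z -> _] := pow_s k i x; move/(congr1 tag).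
  (* Rotating first from [x] round to 0 and then on to [y] avoids the truncated difference
     [y - x]. *)
  case: i / ji x => x; exists (y + (nth 0 rho j - x)).
  have [z -> Ez] := pow_s (y + (nth 0 rho j - x)) j x.
  congr Tagged; apply: val_inj; rewrite /= Ez addnCA subnKC ?modnDr.
    by rewrite modn_small // ltn_ord.
  by rewrite ltnW // ltn_ord.
(* Nonempty blocks ensure that distinct indices give distinct orbits. *)
have rho_pos (i : 'I_(size rho)) : 0 < nth 0 rho i.
  by rewrite ltnW //; apply: (allP rho_gt1); apply: mem_nth.
have block_card (i : 'I_(size rho)) : #|[set v : T | tag v == i]| = nth 0 rho i.
  have -> : [set v : T | tag v == i] = [set Tagged T_ x | x : T_ i].
    apply/setP=> -[j y]; rewrite inE /=.
    apply/eqP/imsetP => [ji | [x _ /(congr1 tag)] //].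
    by case: i / ji; exists y.
  by rewrite card_imset ?card_ord // => x y /eqP; rewrite eq_Tagged => /eqP.
have perm_s : perm_eq [seq #|X| | X : {set T} in porbits s] rho.
  have rhoE : [seq #|pred_of_set X| | X <-
      [seq [set v : T | tag v == i] | i : 'I_(size rho) <- enum 'I_(size rho)]]
      = rho.
    rewrite -map_comp (eq_map block_card) (map_comp (nth 0 rho) val).
    by rewrite val_enum_ord; apply: mkseq_nth.
  rewrite -[X in perm_eq _ X]rhoE.
  apply: perm_map; apply: uniq_perm => [||X]; first exact: enum_uniq.
    rewrite map_inj_uniq ?enum_uniq // => i j.
    move/setP/(_ (Tagged T_ (Ordinal (rho_pos i)))).
    by rewrite !inE eqxx => /esym/eqP.
  rewrite mem_enum; apply/imsetP/mapP => [[u _ ->] | [i _ ->]].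
    by exists (tag u); rewrite ?mem_enum.
  by exists (Tagged T_ (Ordinal (rho_pos i))).
have type_s : proper_type s = rho.
  apply: (sorted_eq geq_trans geq_anti) => //.
    exact: sort_sorted geq_total _.
  rewrite perm_sort; apply: perm_trans (perm_filter _ perm_s) _.
  by move/all_filterP: rho_gt1 => ->.
have card_T : #|{: T}| = sumn rho.
  rewrite card_tagged (eq_map (fun i => card_ord _)) (map_comp (nth 0 rho) val).
  by rewrite val_enum_ord; congr sumn; apply: mkseq_nth.
have T_le : #|{: T}| <= n by rewrite card_T.
have f_inj : injective (fun u : T => widen_ord T_le (enum_rank u)).
  by move=> u v /(congr1 val) /= /ord_inj/enum_rank_inj.
by exists (ext_perm f_inj s); rewrite proper_type_ext_perm.
Qed.

(** * Counting factorizations by the joint support of the factors *)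

Section Counting.

Variables lambda delta : seq nat.

Definition factorizations (T : finType) (z : {perm T}) :=
  [set u : {perm T} * {perm T} |
    [&& proper_type u.1 == lambda, proper_type u.2 == delta
      & (u.1 * u.2)%g == z]].

Definition factorizations_on (T : finType) (z : {perm T}) (D : {set T}) :=
  [set u in factorizations z | moved u.1 :|: moved u.2 == D].

Lemma moved_mul (T : finType) (s t : {perm T}) :
  moved (s * t)%g \subset moved s :|: moved t.
Proof.
apply/subsetP=> x; rewrite !inE permM; apply: contraR.
by rewrite negb_or !negbK => /andP[/eqP -> ].
Qed.

(** The union of the two supports has at most as many points as the supports have in total, which is
    [sumn lambda + sumn delta]. *)
Lemma card_factorizations_on_gt (T : finType) (z : {perm T}) (D : {set T}) :
  sumn lambda + sumn delta < #|D| -> #|factorizations_on z D| = 0.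
Proof.
move=> D_gt; apply/eqP; rewrite cards_eq0; apply/eqP/setP=> u; rewrite !inE.
apply/negP=> /andP[/and3P[/eqP type1 /eqP type2 _] /eqP DE].
move: D_gt; rewrite ltnNge -type1 -type2 !sumn_proper_type -DE.
by rewrite -cardsUI leq_addr.
Qed.

(** Factors with joint support [f @: D] move only points in the image of [f], so they are extensions
    of unique permutations of [T1]. *)
Lemma card_factorizations_on_ext (T1 T2 : finType) (f : T1 -> T2)
    (f_inj : injective f) (s : {perm T1}) (D : {set T1}) :
  #|factorizations_on (ext_perm f_inj s) (f @: D)| = #|factorizations_on s D|.
Proof.
pose ext2 (u : {perm T1} * {perm T1}) :=
  (ext_perm f_inj u.1, ext_perm f_inj u.2).
have ext2_inj : injective ext2.
  by move=> [x y] [x' y'] [/ext_perm_inj -> /ext_perm_inj ->].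
rewrite -(card_imset _ ext2_inj); apply: eq_card => -[x y].
have DE (s1 s2 : {perm T1}) : (f @: (moved s1 :|: moved s2) == f @: D) =
    (moved s1 :|: moved s2 == D) by rewrite (inj_eq (imset_inj f_inj)).
apply/idP/imsetP => [|[[x' y']]]; last first.
  rewrite !inE /= => /andP[/and3P[typex typey /eqP xyE] movedE] [-> ->].
  rewrite !proper_type_ext_perm typex typey -ext_permM xyE eqxx /=.
  by rewrite !moved_ext_perm -imsetU DE.
rewrite !inE /= => /andP[/and3P[typex typey xyE] movedE].
have sub (t : {perm T2}) : moved t \subset moved x :|: moved y ->
    exists t', ext_perm f_inj t' = t.
  move=> tD; apply: ext_perm_onto; apply: subset_trans tD _.
  by rewrite (eqP movedE); apply/imsetS/subset_predT.
have [x' xE] := sub x (subsetUl _ _); have [y' yE] := sub y (subsetUr _ _).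
move: typex typey xyE movedE.
rewrite -xE -yE -ext_permM !moved_ext_perm -imsetU.
rewrite !proper_type_ext_perm (inj_eq (@ext_perm_inj _ _ _ f_inj)) DE.
move=> typex typey xyE movedE; exists (x', y') => //.
by rewrite !inE /= typex typey xyE.
Qed.

(** An intertwiner with image [D] exhibits [t] as the extension of [s], which reduces the claim to
    invariance under extension. *)
Lemma eq_card_factorizations_on (T1 T2 : finType) (s : {perm T1})
    (t : {perm T2}) (D : {set T2}) :
    moved t \subset D -> #|D| = #|T1| -> proper_type s = proper_type t ->
  #|factorizations_on t D| = #|factorizations_on s setT|.
Proof.
move=> tD card_D st.
have [f [f_inj fD ft]] := proper_type_intertwine tD card_D st.
have fT : f @: [set: T1] = D.
  by rewrite -fD; apply/setP=> y; apply/imsetP/imsetP=> -[x _ ->]; exists x.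
rewrite -(card_factorizations_on_ext f_inj) fT.
by rewrite (ext_perm_uniq f_inj _ ft) // fD.
Qed.

(* This is M_k. The default value [0] is never reached for a proper [rho], by
   [proper_type_exists]. *)
Definition full_count (rho : seq nat) (k : nat) : nat :=
  if [pick z : 'S_(sumn rho + k) | proper_type z == rho] is Some z
  then #|factorizations_on z setT| else 0.

(** [moved z :|: D] has as many points as the ordinal on which [full_count] is computed, and the
    permutation picked there has the proper type of [z]; which one is picked does not affect the
    count. *)
Lemma card_factorizations_on (n : nat) (z : 'S_n) (D : {set 'I_n}) :
  D \subset ~: moved z ->
  #|factorizations_on z (moved z :|: D)| = full_count (proper_type z) #|D|.
Proof.
move=> Dz; rewrite /full_count; case: pickP => [s /eqP sz | no_s].
  apply: eq_card_factorizations_on => //; first exact: subsetUl.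
  rewrite card_ord sumn_proper_type cardsU.
  move: Dz; rewrite -disjoints_subset disjoint_sym -setI_eq0 => /eqP->.
  by rewrite cards0 subn0.
have := proper_type_exists (proper_partition_type z) (leq_addr #|D| _).
by case=> s /eqP sz; move: (no_s s); rewrite sz.
Qed.

Lemma full_count_gt (rho : seq nat) (k : nat) :
  sumn lambda + sumn delta < k -> full_count rho k = 0.
Proof.
move=> k_gt; rewrite /full_count; case: pickP => // z _.
apply: card_factorizations_on_gt; rewrite cardsT card_ord.
exact: leq_trans k_gt (leq_addl _ _).
Qed.

Lemma card_factorizations (n : nat) (z : 'S_n) :
  #|factorizations z| =
  \sum_(k < (sumn lambda + sumn delta).+1)
     full_count (proper_type z) k * 'C(n - sumn (proper_type z), k).
Proof.
set K := sumn lambda + _; set M := full_count _.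
rewrite -sum1_card (partition_big
  (fun u : 'S_n * 'S_n => (moved u.1 :|: moved u.2) :\: moved z)
  (fun D => D \subset ~: moved z)) /=; last first.
  by move=> u _; rewrite setDE subsetIr.
transitivity (\sum_(D : {set 'I_n} | D \subset ~: moved z) M #|D|).
  apply: eq_bigr => D Dz; rewrite /M -card_factorizations_on // -sum1_card.
  apply: eq_bigl => u; rewrite [RHS]inE; case uz: (u \in _) => //=.
  (* The factors together move every point moved by [z], so their joint support minus [moved z] is
     [D] exactly when the joint support is [moved z :|: D]. *)
  have {uz} zu : moved z \subset moved u.1 :|: moved u.2.
    by move: uz; rewrite inE => /and3P[_ _ /eqP <-]; apply: moved_mul.
  apply/eqP/eqP => [<- | ->].
    by rewrite -{1}(setID (moved u.1 :|: moved u.2) (moved z)) (setIidPr zu).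
  by rewrite setDUl setDv set0U; apply/setDidPl; rewrite disjoints_subset.
rewrite (bigID (fun D : {set 'I_n} => #|D| <= K)) /=.
rewrite [X in _ + X]big1 ?addn0; last first.
  by move=> D /andP[_]; rewrite -ltnNge; apply: full_count_gt.
(* Only sets with at most [K] elements remain, so [inord] returns the true cardinality; grouping by
   it leaves the number of [k]-subsets of the complement of [moved z]. *)
rewrite (partition_big (fun D : {set 'I_n} => inord #|D| : 'I_K.+1) predT) //=.
have -> : n - sumn (proper_type z) = #|~: moved z|.
  by rewrite sumn_proper_type [RHS]cardsCs setCK card_ord.
apply: eq_bigr => k _; rewrite -cards_draws mulnC -sum_nat_const.
apply: eq_big => [D | D /andP[/andP[_ DK] /eqP <-]]; last by rewrite inordK.
rewrite inE -andbA; congr andb; apply/andP/eqP => [[DK /eqP <-] | ->].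
  by rewrite inordK.
by split; [rewrite -ltnS ltn_ord | apply/eqP/val_inj; rewrite /= inordK].
Qed.

(** * The coefficient polynomials and their values *)

Lemma falling_factorial_eval (m k n : nat) : m <= n ->
  ((Defs.falling_factorial m k).[n%:R] = ((n - m) ^_ k)%:R)%R.
Proof.
move=> le_mn; rewrite /Defs.falling_factorial horner_prod.
elim: k => [|k IHk]; first by rewrite big_ord0 ffactn0.
rewrite big_ord_recr /= IHk hornerXsubC ffactnSr natrM.
(* Once [k] exceeds [n - m] the product is already zero, so the truncation of [n - m - k] does no
   harm. *)
case: (leqP k (n - m)) => [le_k | lt_k]; last by rewrite ffact_small ?mul0r.
by rewrite -natrB -?subnDA // -leq_subRL.
Qed.

(** Neither the range of summation nor [full_count] depends on [n], so a single polynomial serves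
    all [n]. *)
Definition coefficient_poly (rho : seq nat) : {poly rat} :=
  (\sum_(k < (sumn lambda + sumn delta).+1)
     ((full_count rho k)%:R / (k`!)%:R) *:
       Defs.falling_factorial (sumn rho) k)%R.

Lemma coefficient_poly_nonneg (rho : seq nat) :
  nonneg_coefficients (sumn rho) (coefficient_poly rho).
Proof.
pose a k : rat := ((full_count rho k)%:R / (k`!)%:R)%R.
exists (mkseq a (sumn lambda + sumn delta).+1); split.
  by apply/allP=> _ /mapP[k _ ->]; rewrite divr_ge0 ?ler0n.
by rewrite size_mkseq; apply: eq_bigr => k _; rewrite nth_mkseq.
Qed.

Lemma coefficient_poly_eval (n : nat) (z : 'S_n) :
  ((coefficient_poly (proper_type z)).[n%:R] = #|factorizations z|%:R)%R.
Proof.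
have le_n : sumn (proper_type z) <= n.
  by rewrite sumn_proper_type -[X in _ <= X]card_ord max_card.
rewrite card_factorizations natr_sum horner_sum; apply: eq_bigr => k _.
rewrite hornerZ falling_factorial_eval // -bin_ffact !natrM mulrACA mulVf.
  by rewrite mulr1.
by rewrite pnatr_eq0 -lt0n fact_gt0.
Qed.

End Counting.

End ProperType.

(** * Coordinates in the group algebra *)

Local Open Scope ring_scope.

Lemma proper_type_mem (n : nat) (z : 'S_n) :
  proper_type z \in proper_partitions n.
Proof.
rewrite mem_proper_partitions proper_partition_type sumn_proper_type.
by rewrite -[X in (_ <= X)%N]card_ord max_card.
Qed.

(** The row of the identity in the matrix of [x] is the basis vector indexed by [x], so these rows
    are already linearly independent. This makes structure coefficients unique. *)
Lemma regular_repr_free (C : fieldType) (gT : finGroupType) (G : {group gT})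
    (a : gT -> C) :
  \sum_(x in G) a x *: regular_repr C G x = 0 -> {in G, forall x, a x = 0}.
Proof.
move=> a0 x Gx.
have rowE y : y \in G ->
    gring_row (regular_repr C G y) = delta_mx 0 (gring_index G y).
  by move=> Gy; rewrite /gring_row rowK gring_indexK // mul1g.
have := congr1 (fun A : 'M_#|G| => gring_row A 0 (gring_index G x)) a0.
rewrite linear_sum linear0 summxE mxE (bigD1 x) //= big1 => [|y /andP[Gy yx]].
  by rewrite addr0 linearZ /= rowE // !mxE !eqxx mulr1.
rewrite linearZ /= rowE // !mxE eqxx /=; case: eqP => [xy|].
  by case/eqP: yx; rewrite -(gring_indexK y Gy) -xy gring_indexK.
by rewrite mulr0.
Qed.

Lemma class_sum_mul (C : fieldType) (n : nat) (lambda delta : seq nat) :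
    proper_partition lambda -> proper_partition delta ->
  class_sum C n lambda *m class_sum C n delta =
  \sum_(z in [set: 'S_n])
     #|factorizations lambda delta z|%:R *: regular_repr C [set: 'S_n] z.
Proof.
move=> lambda_proper delta_proper.
rewrite /class_sum /gset_mx !cycle_class_proper // mulmx_suml.
under eq_bigr do rewrite mulmx_sumr.
rewrite pair_big /= (partition_big (fun u : 'S_n * 'S_n => (u.1 * u.2)%g)
  (mem [set: 'S_n])) => [|u _]; last by rewrite /= inE.
apply: eq_bigr => z _; rewrite -sumr_const scaler_suml.
apply: eq_big => [u | u /andP[_ /eqP <-]]; first by rewrite !inE andbA.
by rewrite scale1r repr_mxM ?inE.
Qed.

(** Each permutation lies in exactly one of the listed classes, that of its proper type. *)
Lemma class_sum_combination (C : fieldType) (n : nat) (c : seq nat -> C) :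
  \sum_(rho <- proper_partitions n) c rho *: class_sum C n rho =
  \sum_(z in [set: 'S_n]) c (proper_type z) *: regular_repr C [set: 'S_n] z.
Proof.
transitivity (\sum_(rho <- proper_partitions n)
    \sum_(z in [set: 'S_n] | proper_type z == rho)
      c rho *: regular_repr C [set: 'S_n] z).
  apply: eq_big_seq => rho.
  rewrite mem_proper_partitions => /andP[rho_proper _].
  rewrite /class_sum /gset_mx cycle_class_proper // scaler_sumr.
  by apply: eq_bigl => z; rewrite !inE.
rewrite (exchange_big_dep (mem [set: 'S_n])) => [|rho z _ /andP[] //].
apply: eq_bigr => z _; under eq_bigl do rewrite inE /= eq_sym.
rewrite big_mkcond (bigD1_seq (proper_type z)) ?proper_type_mem //=; last first.
  exact: proper_partitions_uniq.
by rewrite eqxx big1 ?addr0 // => rho /negbTE->.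
Qed.

Unset Implicit Arguments.

Theorem corollary6p4 (C : numClosedFieldType) (lambda delta : seq nat)
    (lambda_proper : proper_partition lambda)
    (delta_proper : proper_partition delta) :
  exists (N : nat) (p : seq nat -> {poly rat}),
    (forall rho : seq nat, proper_partition rho ->
       nonneg_coefficients (sumn rho) (p rho)) /\
    (forall n : nat, (N <= n)%N -> forall c : seq nat -> C,
       structure_coefficients n lambda delta c <->
       (forall rho : seq nat, rho \in proper_partitions n ->
          c rho = ratr (p rho).[n%:R])).
Proof.
(* The count is exact for every [n], as the [rho] to be compared satisfy [sumn rho <= n]; hence the
   threshold 0. *)
exists 0%N, (coefficient_poly lambda delta); split=> [rho _ | n _ c].
  exact: coefficient_poly_nonneg.
rewrite /structure_coefficients class_sum_mul // class_sum_combination.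
split=> [E rho | cE].
  rewrite mem_proper_partitions => /andP[rho_proper rho_n].
  (* The coefficient at [rho] is read off at one permutation [z] of that type. *)
  have [z <-] := proper_type_exists rho_proper rho_n.
  rewrite coefficient_poly_eval ratr_nat.
  apply/eqP; rewrite -subr_eq0; apply/eqP.
  (* The two expansions in the regular representation have difference zero, so linear independence
     forces each [a z] to vanish. *)
  pose a (z : 'S_n) : C :=
    c (proper_type z) - #|factorizations lambda delta z|%:R.
  apply: (@regular_repr_free _ _ [set: 'S_n]%G a); last by rewrite inE.
  rewrite /a; under eq_bigr do rewrite scalerBl.
  by rewrite sumrB -E subrr.
apply: eq_bigr => z _; rewrite cE ?proper_type_mem //.
by rewrite coefficient_poly_eval ratr_nat.
Qed.
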